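(* There exists an absolute constant $C>0$ such that the following holds. Let $t \ge 1$, let $n, M$ be natural numbers with $n < M$, and let $A=(a_{i,j})$ be an $n \times M$ matrix whose rows are orthonormal. Suppose that for all $j=1,\dots,M$ $$\sqrt{\frac{M}{n}} \cdot \left( \sum_{i=1}^n a_{i,j}^2 \right)^{1/2} \le t .$$ Then for every $\varepsilon>0$ there exists a set $I \subset \{1,\dots,M\}$ such that $$|I| \le C \cdot \frac{t^2}{\varepsilon^2} \cdot n \cdot \log n$$ and for all $x \in \mathbb{R}^n$ $$(1-\varepsilon)\cdot \|x\| \le \sqrt{\frac{M}{|I|}} \cdot \|R_I A^T x\| \le (1+\varepsilon)\cdot \|x\| .$$
   Context: Matrices have real entries. $\|\cdot\|$ denotes the standard Euclidean ($\ell_2$) norm, $|I|$ is the cardinality of the set $I$, and $A^T$ is the transpose of $A$. $R_I:\mathbb{R}^M\to\mathbb{R}^M$ is the orthogonal projection onto $\mathrm{span}\{e_i : i\in I\}$, where $\{e_i\}_{i=1}^M$ is the standard basis of $\mathbb{R}^M$.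
   Formalization: The formal theorem assumes n ≥ 2: for n = 1 the bound gives |I| ≤ 0, so I is empty and the estimate fails for ε < 1. If I is empty, which large ε forces, the middle term is read as 0. *)

(* Defs.v *)
From HB Require Import structures.
From mathcomp Require Import all_boot all_order all_algebra.
From mathcomp Require Import reals exp.

Set Implicit Arguments.
Unset Strict Implicit.
Unset Printing Implicit Defensive.

Import Order.TTheory GRing.Theory Num.Theory.
Local Open Scope ring_scope.

Definition dot (R : realType) (m : nat) (x y : 'cV[R]_m) : R :=
  \sum_i x i 0 * y i 0.

(* `|x| on matrices is the sup norm in MathComp-Analysis, hence a separate
   Euclidean norm. *)
Definition enorm (R : realType) (m : nat) (x : 'cV[R]_m) : R :=
  Num.sqrt (\sum_i x i 0 ^+ 2).

Definition std_basis (R : realType) (m : nat) (i : 'I_m) : 'cV[R]_m :=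
  delta_mx i 0.

Definition orthonormal_rows (R : realType) (n m : nat) (A : 'M[R]_(n, m)) : Prop :=
  forall i j : 'I_n, dot (row i A)^T (row j A)^T = (i == j)%:R.

(* The orthogonal projection onto the span of the e_i, i \in I, expanded in this
   orthonormal family; coord_projP states its defining property. *)
Definition coord_proj (R : realType) (m : nat) (I : {set 'I_m}) (x : 'cV[R]_m) :
    'cV[R]_m :=
  \sum_(i in I) dot x (std_basis R i) *: std_basis R i.

Lemma dot_std_basis (R : realType) (m : nat) (x : 'cV[R]_m) (i : 'I_m) :
  dot x (std_basis R i) = x i 0.
Proof.
rewrite /dot (bigD1 i) //= big1 ?addr0 => [|k ki]; rewrite mxE ?eqxx ?mulr1 //.
by rewrite (negPf ki) mulr0.
Qed.

Lemma coord_projE (R : realType) (m : nat) (I : {set 'I_m}) (x : 'cV[R]_m)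
    (i : 'I_m) :
  coord_proj I x i 0 = if i \in I then x i 0 else 0.
Proof.
rewrite /coord_proj summxE; case: ifPn => iI.
  rewrite (bigD1 i) //= big1 ?addr0 => [|k /andP[_ ki]];
    by rewrite dot_std_basis !mxE ?eqxx ?mulr1 // eq_sym (negPf ki) mulr0.
rewrite big1 // => k kI; rewrite !mxE; case: eqP => [ik|]; last by rewrite mulr0.
by rewrite ik kI in iI.
Qed.

Lemma coord_projP (R : realType) (m : nat) (I : {set 'I_m}) (x : 'cV[R]_m) :
  let V := <<[seq std_basis R i | i in I]>>%VS in
  coord_proj I x \in V /\ (forall y, y \in V -> dot (x - coord_proj I x) y = 0).
Proof.
split.
  by apply: memv_suml => i iI; apply/memvZ/memv_span/image_f.
move=> y /coord_span ->; rewrite /dot.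
under eq_bigr do rewrite summxE mulr_sumr.
rewrite exchange_big big1 //= => k _.
have /imageP[i iI ei] : [seq std_basis R i | i in I]`_k \in
    [seq std_basis R i | i in I] by apply: mem_nth; rewrite size_image ltn_ord.
under eq_bigr do rewrite [X in _ * X]mxE mulrCA.
by rewrite -mulr_sumr ei -/(dot _ _) dot_std_basis !mxE coord_projE iI subrr mulr0.
Qed.

(* Main.v *)
Require Import Defs.
From mathcomp Require Import all_boot all_order all_algebra.
From mathcomp Require Import reals exp.
From mathcomp Require Import ring lra zify.

Set Implicit Arguments.
Unset Strict Implicit.
Unset Printing Implicit Defensive.

Import Order.TTheory GRing.Theory Num.Theory.
Local Open Scope ring_scope.

(** Write a_j for the columns of A.  Orthonormality of the rows says that the
rank one matrices a_j a_j^T add up to the identity, and the hypothesis says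
that each of them has norm at most t^2 n / M.  A set I with the two-sided norm
estimate is one for which (M / |I|) times the sum over I of the a_j a_j^T is
close to the identity.  Such an I is reached from the full index set by
repeatedly throwing away about half of the indices.

One halving step needs signs for which the signed sum X of symmetric matrices
H_j is small.  They come from a noncommutative Khintchine inequality
[moment_step]: averaged over all signs, tr X^(2h+2) is at most (2h+1) v times
tr X^(2h), where v bounds the sum of the H_j^2.  Its proof isolates one sign,
telescopes the difference of powers obtained by flipping that sign, and bounds
the resulting traces tr(H W^q H Y^(m-q)) by the two extreme ones
[mixed_trace_endpoints].  This last bound follows from the positivity of
tr(G^T G), without diagonalizing W and Y.  Taking p of the order of log n, some choice of signs
has tr X^(2p) <= (4 p v)^p; choosing p to be a power of two, iterated
Cauchy-Schwarz turns this into |<x, X x>| <= sqrt(4 p v) |x|^2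
[small_signed_sum].

If all a_j a_j^T have norm at most r, the relative error after l halvings is of
order sqrt(2^l p r): the errors grow geometrically, so the last one dominates
[iterated_halving].  Halving as long as this is below eps / 2 leaves
|I| ~ M / 2^l ~ p M r / eps^2 ~ t^2 n log n / eps^2.  To know that |I| itself is
close to M / 2^l, each a_j a_j^T is enlarged by a diagonal entry 1 / M in one
extra coordinate [atom]; these entries count the surviving indices, and the same
estimate controls them.  When even the first halving is too costly, M is already
below the required bound and I is everything; when eps >= 1, the empty set
works. *)

(** * Inner products and traces *)

Lemma dotE (R : realType) m (x y : 'cV[R]_m) : dot x y = (x^T *m y) 0 0.
Proof. by rewrite mxE; apply: eq_bigr => i _; rewrite mxE. Qed.

Lemma dot_mulmx (R : realType) m n (G : 'M[R]_(m, n)) x y :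
  dot (G *m x) y = dot x (G^T *m y).
Proof. by rewrite !dotE trmx_mul mulmxA. Qed.

Lemma dot_ge0 (R : realType) m (x : 'cV[R]_m) : 0 <= dot x x.
Proof. by apply: sumr_ge0 => i _; rewrite -expr2 sqr_ge0. Qed.

Lemma cauchy_schwarz (R : realType) m (x y : 'cV[R]_m) :
  dot x y ^+ 2 <= dot x x * dot y y.
Proof.
have e1 : dot x x * dot y y = \sum_i \sum_j x i 0 * x i 0 * (y j 0 * y j 0).
  by rewrite /dot big_distrlr.
have e2 : dot x x * dot y y = \sum_i \sum_j x j 0 * x j 0 * (y i 0 * y i 0).
  by rewrite e1 exchange_big.
have e3 : dot x y ^+ 2 = \sum_i \sum_j x i 0 * y i 0 * (x j 0 * y j 0).
  by rewrite expr2 /dot big_distrlr.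
suff : 0 <= dot x x * dot y y - dot x y ^+ 2 *+ 2 + dot x x * dot y y by lra.
rewrite {1}e1 e2 e3 -sumrMnl -sumrB -big_split /=; apply: sumr_ge0 => i _.
rewrite -sumrMnl -sumrB -big_split /=; apply: sumr_ge0 => j _.
have := sqr_ge0 (x i 0 * y j 0 - x j 0 * y i 0); lra.
Qed.

Lemma mxtrace_gram (R : realType) m n (G : 'M[R]_(m, n)) :
  \tr (G^T *m G) = \sum_k dot (col k G) (col k G).
Proof.
apply: eq_bigr => k _; rewrite mxE; apply: eq_bigr => i _.
by rewrite !mxE.
Qed.

Lemma mxtrace_gram_ge0 (R : realType) m n (G : 'M[R]_(m, n)) :
  0 <= \tr (G^T *m G).
Proof. by rewrite mxtrace_gram; apply: sumr_ge0 => k _; apply: dot_ge0. Qed.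

Lemma mxtrace_am_gm (R : realType) m n (P Q : 'M[R]_(m, n)) :
  2 * \tr (P^T *m Q) <= \tr (P^T *m P) + \tr (Q^T *m Q).
Proof.
have := mxtrace_gram_ge0 (P - Q).
rewrite [(P - Q)^T]linearB /= mulmxBl !mulmxBr !linearB /=.
rewrite -(mxtrace_tr (Q^T *m P)) trmx_mul trmxK; lra.
Qed.

Lemma trmx_exp (R : realType) n (X : 'M[R]_n.+1) k : (X ^+ k)^T = X^T ^+ k.
Proof.
elim: k => [|k IH]; first by rewrite !expr0 trmx1.
by rewrite exprS exprSr -!mulmxE trmx_mul IH.
Qed.

(** * Mixed traces *)

Definition mixed_trace (R : realType) n (H W Y : 'M[R]_n.+1) a b :=
  \tr (H * W ^+ a * (H * Y ^+ b)).

Lemma mixed_traceE (R : realType) n (H W Y : 'M[R]_n.+1) a b c d :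
  H^T = H -> W^T = W -> Y^T = Y ->
  \tr ((W ^+ a * H * Y ^+ b)^T *m (W ^+ c * H * Y ^+ d)) =
    mixed_trace H W Y (a + c) (b + d).
Proof.
move=> sH sW sY; rewrite -!mulmxE !trmx_mul !trmx_exp sH sW sY !mulmxE.
rewrite -!mulrA -mulmxE mxtrace_mulC !mulmxE /mixed_trace (addnC b) !exprD !mulrA.
by [].
Qed.

(** The mixed traces with exponents of even sum are the pairings of the matrices
W^a H Y^b, so the arithmetic-geometric inequality for the Frobenius product
makes them midpoint convex in the exponents. *)
Lemma mixed_trace_midpoint (R : realType) n (H W Y : 'M[R]_n.+1) a b c d :
  H^T = H -> W^T = W -> Y^T = Y ->
  2 * mixed_trace H W Y (a + c) (b + d) <=
    mixed_trace H W Y (a + a) (b + b) + mixed_trace H W Y (c + c) (d + d).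
Proof. by move=> sH sW sY; rewrite -!mixed_traceE //; apply: mxtrace_am_gm. Qed.

(** A maximum principle.  The symmetrized mixed trace f satisfies
2 f(j) <= f(0) + f(2j) for j <= h by midpoint convexity, and f(2h - j) = f(j).
Evaluated at a maximizer j, which may be taken at most h, this gives
2 f(j) <= f(0) + f(j), that is max f <= f(0). *)
Lemma mixed_trace_endpoints (R : realType) n (H W Y : 'M[R]_n.+1) h q :
  H^T = H -> W^T = W -> Y^T = Y -> (q <= h.*2)%N ->
  mixed_trace H W Y q (h.*2 - q) + mixed_trace H W Y (h.*2 - q) q <=
    mixed_trace H W Y 0 h.*2 + mixed_trace H W Y h.*2 0.
Proof.
move=> sH sW sY qm.
pose f j := mixed_trace H W Y j (h.*2 - j) + mixed_trace H W Y (h.*2 - j) j.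
have fC j : (j <= h.*2)%N -> f (h.*2 - j)%N = f j.
  by move=> jm; rewrite /f subKn // addrC.
have f_mid j : (j <= h)%N -> 2 * f j <= f 0%N + f j.*2.
  move=> jh; have -> : f j = mixed_trace H W Y (0 + j) (h + (h - j)) +
     mixed_trace H W Y (h + (h - j)) (0 + j).
    by rewrite /f add0n addnBA // addnn.
  have := mixed_trace_midpoint 0 h j (h - j) sH sW sY.
  have := mixed_trace_midpoint h 0 (h - j) j sH sW sY.
  have e : (h - j + (h - j) = h.*2 - j.*2)%N by rewrite addnn doubleB.
  rewrite /f subn0 e !addnn; lra.
have [k _ kmax] := @arg_maxP _ _ _ (ord0 : 'I_h.*2.+1) xpredT (fun i => f i) isT.
have fle j : (j <= h.*2)%N -> f j <= f k.
  by move=> jm; apply: (kmax (Ordinal (jm : (j < h.*2.+1)%N))).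
have [k' k'h fk] : exists2 k', (k' <= h)%N & f k' = f k.
  have km : (k <= h.*2)%N by rewrite -ltnS.
  have [kh|kh] := leqP k h; first by exists k.
  by exists (h.*2 - k)%N; [lia | apply: fC].
have := fle _ qm; have := f_mid _ k'h.
have := fle k'.*2; rewrite leq_double => /(_ k'h).
have -> : f 0%N = mixed_trace H W Y 0 h.*2 + mixed_trace H W Y h.*2 0 by rewrite /f subn0.
by rewrite -/(f q) fk; lra.
Qed.

Lemma subrXX_telescope (S : nzRingType) (a b : S) n :
  a ^+ n - b ^+ n = \sum_(q < n) a ^+ q * (a - b) * b ^+ (n.-1 - q).
Proof.
elim: n => [|n IH]; first by rewrite big_ord0 subrr.
rewrite big_ord_recl /= expr0 mul1r subn0.
transitivity ((a - b) * b ^+ n + a * (a ^+ n - b ^+ n)).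
  by rewrite mulrBl mulrBr -!exprS [RHS]addrC addrA subrK.
rewrite IH mulr_sumr; congr (_ + _); apply: eq_bigr => q _.
by rewrite exprS !mulrA; congr (_ * _ ^+ _); rewrite /bump; lia.
Qed.

(** The telescoped difference is a sum of mixed traces; pairing the terms q and
2h - q, each pair is at most the pair of extreme ones. *)
Lemma mxtrace_exp_gap (R : realType) n (H W Y : 'M[R]_n.+1) h :
  H^T = H -> W^T = W -> Y^T = Y -> W - Y = H *+ 2 ->
  \tr (H * (W ^+ h.*2.+1 - Y ^+ h.*2.+1)) <=
    h.*2.+1%:R * (\tr (H * H * W ^+ h.*2) + \tr (H * H * Y ^+ h.*2)).
Proof.
move=> sH sW sY WY.
have -> : \tr (H * H * W ^+ h.*2) + \tr (H * H * Y ^+ h.*2) =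
    mixed_trace H W Y 0 h.*2 + mixed_trace H W Y h.*2 0.
  rewrite /mixed_trace !expr0 !mulr1 addrC [in RHS]mulrA; congr (_ + _).
  by rewrite -mulrA -mulmxE mxtrace_mulC mulmxE.
pose c q := mixed_trace H W Y q (h.*2 - q).
have -> : \tr (H * (W ^+ h.*2.+1 - Y ^+ h.*2.+1)) =
    \sum_(q < h.*2.+1) c q + \sum_(q < h.*2.+1) c q.
  rewrite subrXX_telescope mulr_sumr raddf_sum -big_split /=.
  apply: eq_bigr => q _; rewrite -mxtraceD WY -mulr2n /c.
  by rewrite mulrnAr mulrnAl mulrnAr !mulrA.
rewrite {2}(reindex_inj rev_ord_inj) -big_split /= mulr_natl.
rewrite -[X in _ *+ X]card_ord -sumr_const; apply: ler_sum => q _.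
have qm : (q <= h.*2)%N by rewrite -ltnS.
by rewrite /c subSS subKn //; apply: mixed_trace_endpoints.
Qed.

(** * A noncommutative Khintchine inequality *)

Definition signed_sum (R : realType) (T : finType) n (H : T -> 'M[R]_n)
    (s : {ffun T -> bool}) : 'M[R]_n :=
  \sum_i (-1) ^+ s i *: H i.

Definition flip (T : finType) (i : T) (s : {ffun T -> bool}) :=
  [ffun j => (j == i) (+) s j].

Lemma flip_inj (T : finType) (i : T) : injective (flip i).
Proof.
by apply: inv_inj => s; apply/ffunP => j; rewrite !ffunE addbA addbb.
Qed.

Lemma signed_sum_flip (R : realType) (T : finType) n (H : T -> 'M[R]_n) i s :
  signed_sum H s - signed_sum H (flip i s) = ((-1) ^+ s i *: H i) *+ 2.
Proof.
rewrite /signed_sum -sumrB (bigD1 i) //= big1 ?addr0 => [|j /negPf ji].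
  by rewrite ffunE eqxx signr_addb expr1 mulN1r scaleNr opprK mulr2n.
by rewrite ffunE ji subrr.
Qed.

Lemma signed_sum_sym (R : realType) (T : finType) n (H : T -> 'M[R]_n) s :
  (forall i, (H i)^T = H i) -> (signed_sum H s)^T = signed_sum H s.
Proof.
move=> sH; rewrite /signed_sum raddf_sum; apply: eq_bigr => i _ /=.
by rewrite linearZ /= sH.
Qed.

(** The left side is the sum over i of the squared Frobenius norms of H_i X^h,
which the hypothesis bounds column by column. *)
Lemma mxtrace_sum_sqr_le (R : realType) (T : finType) n (H : T -> 'M[R]_n.+1)
    (v : R) (X : 'M[R]_n.+1) h :
  (forall i, (H i)^T = H i) ->
  (forall x, \sum_i dot (H i *m x) (H i *m x) <= v * dot x x) ->
  X^T = X ->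
  \sum_i \tr (H i * H i * X ^+ h.*2) <= v * \tr (X ^+ h.*2).
Proof.
move=> sH Hv sX.
have XX : X ^+ h.*2 = (X ^+ h)^T *m X ^+ h.
  by rewrite trmx_exp sX mulmxE -exprD addnn.
rewrite XX mxtrace_gram mulr_sumr.
under eq_bigr => i _.
  have -> : \tr (H i * H i * ((X ^+ h)^T *m X ^+ h)) =
      \tr ((H i *m X ^+ h)^T *m (H i *m X ^+ h)).
    rewrite trmx_mul sH mulmxE !mulrA trmx_exp sX.
    by rewrite -mulmxE mxtrace_mulC !mulmxE !mulrA.
  rewrite mxtrace_gram.
  under eq_bigr do rewrite colE -mulmxA -colE.
  over.
by rewrite exchange_big /=; apply: ler_sum => k _; apply: Hv.
Qed.

(** Writing one factor of X^(2h+2) as the signed sum, each i contributes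
tr(s_i H_i X^(2h+1)).  Averaging with the sign vector flipped at i replaces
X^(2h+1) by half the difference of the odd powers of two matrices that differ by
2 s_i H_i, to which [mxtrace_exp_gap] applies. *)
Lemma moment_step (R : realType) (T : finType) n (H : T -> 'M[R]_n.+1)
    (v : R) h :
  (forall i, (H i)^T = H i) ->
  (forall x, \sum_i dot (H i *m x) (H i *m x) <= v * dot x x) ->
  \sum_s \tr (signed_sum H s ^+ h.+1.*2) <=
    h.*2.+1%:R * v * \sum_s \tr (signed_sum H s ^+ h.*2).
Proof.
move=> sH Hv; set X := signed_sum H.
have sX s : (X s)^T = X s by apply: signed_sum_sym.
have step i : \sum_(s : {ffun T -> bool}) \tr (((-1) ^+ s i *: H i) * X s ^+ h.*2.+1) <=
    h.*2.+1%:R * \sum_s \tr (H i * H i * X s ^+ h.*2).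
  (* Both sides are doubled and one copy of each is reindexed by the flip at i. *)
  rewrite -(ler_pM2l (ltr0n _ 2)) /= mulr2n !mulrDl !mul1r.
  rewrite {2}(reindex_inj (@flip_inj _ i)) -big_split /=.
  rewrite -mulrDr [X in _ * (_ + X)](reindex_inj (@flip_inj _ i)) -big_split /= mulr_sumr.
  apply: ler_sum => s _.
  have := @mxtrace_exp_gap _ _ ((-1) ^+ s i *: H i) (X s) (X (flip i s)) h.
  rewrite linearZ /= sH !sX -/(X _) signed_sum_flip => /(_ erefl erefl erefl erefl).
  have -> : ((-1) ^+ s i *: H i) * ((-1) ^+ s i *: H i) = H i * H i.
    by rewrite -scalerAl -scalerAr scalerA -expr2 sqrr_sign scale1r.
  rewrite ffunE eqxx signr_addb expr1 mulN1r scaleNr.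
  by rewrite mulNr [\tr (- _)]linearN /= -linearB /= -mulrBr.
have -> : \sum_s \tr (X s ^+ h.+1.*2) =
    \sum_i \sum_(s : {ffun T -> bool}) \tr (((-1) ^+ s i *: H i) * X s ^+ h.*2.+1).
  rewrite [RHS]exchange_big /=; apply: eq_bigr => s _.
  by rewrite doubleS exprS {1}/X /signed_sum mulr_suml raddf_sum.
apply: (le_trans (ler_sum _ (fun i _ => step i))).
rewrite -mulr_sumr -mulrA ler_wpM2l // exchange_big mulr_sumr /=.
by apply: ler_sum => s _; apply: mxtrace_sum_sqr_le.
Qed.

Lemma moment_bound (R : realType) (T : finType) n (H : T -> 'M[R]_n.+1)
    (v : R) h p :
  0 <= v -> (h <= p)%N ->
  (forall i, (H i)^T = H i) ->
  (forall x, \sum_i dot (H i *m x) (H i *m x) <= v * dot x x) ->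
  \sum_s \tr (signed_sum H s ^+ h.*2) <=
    \sum_(s : {ffun T -> bool}) (p.*2%:R * v) ^+ h * n.+1%:R.
Proof.
move=> v0 hp sH Hv; elim: h hp => [|h IH] hp.
  by apply: ler_sum => s _; rewrite !expr0 mul1r mxtrace1.
apply: (le_trans (moment_step h sH Hv)).
under [leRHS]eq_bigr do rewrite exprS -mulrA.
rewrite -mulr_sumr ler_pM ?mulr_ge0 //.
- apply: sumr_ge0 => s _; rewrite -addnn exprD -{1}(signed_sum_sym s sH).
  by rewrite -trmx_exp -mulmxE mxtrace_gram_ge0.
- by rewrite ler_wpM2r // ler_nat; lia.
- by apply: IH; apply: ltnW.
Qed.

Lemma exists_small_moment (R : realType) (T : finType) n (H : T -> 'M[R]_n.+1)
    (v : R) p :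
  0 <= v ->
  (forall i, (H i)^T = H i) ->
  (forall x, \sum_i dot (H i *m x) (H i *m x) <= v * dot x x) ->
  exists s, \tr (signed_sum H s ^+ p.*2) <= (p.*2%:R * v) ^+ p * n.+1%:R.
Proof.
move=> v0 sH Hv; apply/existsP; apply: contraT; rewrite negb_exists => /forallP gt.
have := moment_bound v0 (leqnn p) sH Hv; rewrite leNgt => /negP[].
apply: ltr_sum => [|s _]; last by rewrite ltNge; apply: gt.
by apply/hasP; exists [ffun => true]; rewrite ?mem_index_enum.
Qed.

(** * From trace moments to quadratic forms *)

(** For a unit vector, <x, Y x>^2 <= <x, Y^2 x>; squaring repeatedly is why the
exponent is a power of two. *)
Lemma dot_exp_pow2 (R : realType) n (X : 'M[R]_n.+1) x k :
  X^T = X -> dot x x = 1 ->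
  dot x (X *m x) ^+ (2 ^ k.+1) <= dot x (X ^+ (2 ^ k.+1) *m x).
Proof.
have sq (Y : 'M[R]_n.+1) : Y^T = Y -> dot x x = 1 ->
    dot x (Y *m x) ^+ 2 <= dot x (Y ^+ 2 *m x).
  move=> sY x1; apply: (le_trans (cauchy_schwarz _ _)); rewrite x1 mul1r.
  by rewrite dot_mulmx sY mulmxA mulmxE expr2.
move=> sX x1; elim: k => [|k IH]; first exact: sq.
rewrite expnSr !exprM; apply: le_trans (sq _ _ x1); last by rewrite trmx_exp sX.
rewrite ler_pXn2r // nnegrE; last by apply: le_trans IH; rewrite expnSr exprM sqr_ge0.
by rewrite expnSr exprM sqr_ge0.
Qed.

Lemma dot_sqr_le_mxtrace (R : realType) n (Y : 'M[R]_n.+1) x :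
  Y^T = Y -> dot x x = 1 -> dot x (Y ^+ 2 *m x) <= \tr (Y ^+ 2).
Proof.
move=> sY x1; rewrite expr2 -mulmxE -{1 3}sY mxtrace_gram.
rewrite -mulmxA -dot_mulmx; apply: ler_sum => i _.
have -> : (Y *m x) i 0 = dot (col i Y) x.
  by rewrite mxE; apply: eq_bigr => j _; rewrite -{1}sY !mxE.
by rewrite -expr2 -[leRHS]mulr1 -x1 cauchy_schwarz.
Qed.

(** After normalizing x, the power of <x, X x> is at most the trace moment. *)
Lemma form_le_of_moment (R : realType) n (X : 'M[R]_n.+1) (v : R) k x :
  X^T = X -> 0 <= v -> \tr (X ^+ (2 ^ k).*2) <= v ^+ (2 ^ k) ->
  `|dot x (X *m x)| <= Num.sqrt v * dot x x.
Proof.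
move=> sX v0 trX.
have [x0|x0] := eqVneq x 0.
  by rewrite x0 mulmx0 /dot !big1 ?mulr0 ?normr0 // => i _; rewrite !mxE mul0r.
have d0 : 0 < dot x x.
  rewrite lt_def dot_ge0 andbT; apply: contraNneq x0 => xx0.
  apply/eqP/matrixP => i j; rewrite ord1 mxE; apply/eqP; rewrite -sqrf_eq0 expr2.
  by move/psumr_eq0P: xx0 => -> // k' _; rewrite -expr2 sqr_ge0.
pose c := (Num.sqrt (dot x x))^-1; pose y := c *: x.
have dZ (u w : 'cV[R]_n.+1) : dot (c *: u) (c *: w) = c ^+ 2 * dot u w.
  by rewrite /dot mulr_sumr; apply: eq_bigr => i _; rewrite !mxE; ring.
have cc : c ^+ 2 = (dot x x)^-1 by rewrite exprVn sqr_sqrtr // ltW.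
have y1 : dot y y = 1 by rewrite dZ cc mulVf // gt_eqF.
have yX : dot y (X *m y) = dot x (X *m x) / dot x x.
  by rewrite -scalemxAr dZ cc mulrC.
suff: `|dot y (X *m y)| <= Num.sqrt v.
  by rewrite yX normrM normfV (gtr0_norm d0) ler_pdivrMr.
rewrite -sqrtr_sqr ler_wsqrtr // -(@ler_pXn2r _ (2 ^ k)) ?nnegrE ?sqr_ge0 ?expn_gt0 //.
apply: le_trans trX; rewrite -exprM -expnS.
apply: (le_trans (dot_exp_pow2 k sX y1)); rewrite -muln2 -expnSr expnSr exprM.
by apply: dot_sqr_le_mxtrace; rewrite // trmx_exp sX.
Qed.

(** The dimension factor in the moment bound is absorbed by 2^p, with p = 2^k,
and so costs only a constant in the norm. *)
Lemma small_signed_sum (R : realType) (T : finType) n (H : T -> 'M[R]_n.+1)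
    (v : R) k :
  (n.+1 <= 2 ^ 2 ^ k)%N -> 0 <= v ->
  (forall i, (H i)^T = H i) ->
  (forall x, \sum_i dot (H i *m x) (H i *m x) <= v * dot x x) ->
  exists s : {ffun T -> bool},
    forall x, `|dot x (signed_sum H s *m x)| <=
      Num.sqrt (4 * (2 ^ k)%:R * v) * dot x x.
Proof.
move=> nk v0 sH Hv; have [s Hs] := exists_small_moment (2 ^ k) v0 sH Hv.
exists s => x; apply: (@form_le_of_moment _ _ _ _ k).
- exact: signed_sum_sym.
- by rewrite !mulr_ge0.
apply: (le_trans Hs).
have -> : 4 * (2 ^ k)%:R * v = (2 ^ k).*2%:R * v * 2 by rewrite -muln2 natrM; ring.
by rewrite [leRHS]exprMn ler_wpM2l ?exprn_ge0 ?mulr_ge0 // -natrX ler_nat.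
Qed.

(** * Halving *)

Definition form (R : realType) (T : finType) n (B : T -> 'M[R]_n)
    (I : {set T}) (x : 'cV[R]_n) : R :=
  \sum_(j in I) dot x (B j *m x).

Lemma dot_signed_sum (R : realType) (T : finType) n (B : T -> 'M[R]_n) s x :
  dot x (signed_sum B s *m x) = \sum_j (-1) ^+ s j * dot x (B j *m x).
Proof.
rewrite /signed_sum mulmx_suml /dot.
under eq_bigr do rewrite summxE mulr_sumr.
rewrite exchange_big; apply: eq_bigr => j _; rewrite mulr_sumr.
by apply: eq_bigr => i _; rewrite -scalemxAl mxE mulrCA.
Qed.

(** J consists of the indices of I with positive sign, so twice its sum minus the
sum over I is a signed sum.  Since the squares of the B_j are at most r B_j, they
add up to at most r b. *)
Lemma halving (R : realType) (T : finType) n (B : T -> 'M[R]_n.+1)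
    (r b : R) k (I : {set T}) :
  (n.+1 <= 2 ^ 2 ^ k)%N -> 0 <= r -> 0 <= b ->
  (forall j, (B j)^T = B j) ->
  (forall j x, dot (B j *m x) (B j *m x) <= r * dot x (B j *m x)) ->
  (forall x, form B I x <= b * dot x x) ->
  exists J : {set T}, forall x,
    `|2 * form B J x - form B I x| <=
      Num.sqrt (4 * (2 ^ k)%:R * (r * b)) * dot x x.
Proof.
move=> nk r0 b0 sB Br BI; pose H j := if j \in I then B j else 0.
have sH j : (H j)^T = H j by rewrite /H; case: ifP; rewrite ?trmx0.
have Hv x : \sum_j dot (H j *m x) (H j *m x) <= r * b * dot x x.
  rewrite (bigID (mem I)) /= [X in _ + X]big1 ?addr0 => [|j /negPf jI].
    rewrite -mulrA; apply: le_trans (ler_wpM2l r0 (BI x)).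
    by rewrite mulr_sumr; apply: ler_sum => j jI; rewrite /H jI.
  by rewrite /H jI mul0mx /dot big1 // => i _; rewrite mxE mul0r.
have [s Hs] := small_signed_sum nk (mulr_ge0 r0 b0) sH Hv.
exists [set j in I | ~~ s j] => x; apply: le_trans (Hs x).
rewrite dot_signed_sum le_eqVlt; apply/orP; left; apply/eqP; congr `|_|.
rewrite /form [in RHS](bigID (mem I)) /= [X in _ = _ + X]big1; last first.
  move=> j /negPf jI; rewrite /H jI mul0mx /dot big1 ?mulr0 // => i _.
  by rewrite mxE mulr0.
rewrite addr0 (eq_bigl (fun j => (j \in I) && ~~ s j)) => [|j]; last by rewrite inE.
rewrite big_mkcondr mulr_sumr -sumrB; apply: eq_bigr => j jI.
rewrite /H jI; case: (s j) => /=; first by rewrite expr1; ring.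
by rewrite expr0; ring.
Qed.

(** The error E_l = 4 sqrt(2^l w) satisfies E_l + sqrt(2^(l+1) w) <= E_(l+1), as
4 + sqrt 2 <= 4 sqrt 2.  While E_l <= 1, the rescaled sums stay below twice the
identity, which is what the next halving needs. *)
Lemma iterated_halving (R : realType) (T : finType) n (B : T -> 'M[R]_n.+1)
    (r : R) k l (w := 4 * (2 ^ k)%:R * r) :
  (n.+1 <= 2 ^ 2 ^ k)%N -> 0 <= r ->
  (forall j, (B j)^T = B j) ->
  (forall j x, dot (B j *m x) (B j *m x) <= r * dot x (B j *m x)) ->
  (forall x, form B [set: T] x = dot x x) ->
  16 * (2 ^+ l * w) <= 1 ->
  exists I : {set T}, forall x,
    `|2 ^+ l * form B I x - dot x x| <= 4 * Num.sqrt (2 ^+ l * w) * dot x x.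
Proof.
move=> nk r0 sB Br BT; have w0 : 0 <= w by rewrite !mulr_ge0.
elim: l => [|l IH] wl.
  exists [set: T] => x; rewrite BT expr0 mul1r subrr normr0.
  by rewrite !mulr_ge0 ?dot_ge0 ?sqrtr_ge0.
have p0 : 0 < 2 ^+ l :> R by rewrite exprn_gt0.
have lw0 : 0 <= 2 ^+ l * w by rewrite mulr_ge0 // ltW.
have wl' : 16 * (2 ^+ l * w) <= 1 by move: wl; rewrite exprS; lra.
have [I HI] := IH wl'; set a := Num.sqrt (2 ^+ l * w) in HI.
have a0 : 0 <= a by apply: sqrtr_ge0.
have a2 : a ^+ 2 = 2 ^+ l * w by rewrite sqr_sqrtr.
have a1 : 4 * a <= 1.
  rewrite -(@ler_pXn2r _ 2) ?nnegrE ?mulr_ge0 // exprMn a2; lra.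
have BI x : form B I x <= 2 / 2 ^+ l * dot x x.
  have := HI x; rewrite ler_norml => /andP[_ up].
  have := ler_wpM2r (dot_ge0 x) a1 => a1x.
  by rewrite mulrAC ler_pdivlMr // [form _ _ _ * _]mulrC; lra.
(* The form over I is at most 2 / 2^l times the identity; this is the bound b
   of the next halving step. *)
have [J HJ] := halving nk r0 (divr_ge0 (ler0n _ 2) (ltW p0)) sB Br BI.
exists J => x; move: HJ => /(_ x).
set b := Num.sqrt (2 ^+ l.+1 * w).
have b0 : 0 <= b by apply: sqrtr_ge0.
have b2 : b ^+ 2 = 2 * (2 ^+ l * w).
  by rewrite sqr_sqrtr exprS; [ring | rewrite -mulrA mulr_ge0].
have ab : 4 * a <= 3 * b.
  rewrite -(@ler_pXn2r _ 2) ?nnegrE ?mulr_ge0 // !exprMn a2 b2; lra.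
have -> : Num.sqrt (4 * (2 ^ k)%:R * (r * (2 / 2 ^+ l))) = b / 2 ^+ l.
  rewrite -[b / _]ger0_norm ?divr_ge0 ?(ltW p0) // -sqrtr_sqr; congr Num.sqrt.
  by rewrite exprMn b2 /w; field; rewrite gt_eqF.
move=> HJ.
have {}HJ : `|2 ^+ l.+1 * form B J x - 2 ^+ l * form B I x| <= b * dot x x.
  move: HJ; rewrite mulrAC ler_pdivlMr // => HJ; apply: le_trans HJ.
  rewrite -{2}(gtr0_norm p0) -normrM le_eqVlt exprS; apply/orP; left.
  by apply/eqP; congr `|_|; ring.
rewrite -[_ - dot x x](subrKA (2 ^+ l * form B I x)).
apply: (le_trans (ler_normD _ _)); apply: (le_trans (lerD HJ (HI x))).
by rewrite -mulrDl ler_wpM2r ?dot_ge0 //; lra.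
Qed.

(** * The columns of a matrix with orthonormal rows *)

Lemma dot_col_mx (R : realType) m n (a b : 'cV[R]_m) (y z : 'cV[R]_n) :
  dot (col_mx a y) (col_mx b z) = dot a b + dot y z.
Proof.
rewrite /dot big_split_ord /=; congr (_ + _); apply: eq_bigr => i _.
  by rewrite !col_mxEu.
by rewrite !col_mxEd.
Qed.

Lemma dot0r (R : realType) m (x : 'cV[R]_m) : dot x 0 = 0.
Proof. by rewrite /dot big1 // => i _; rewrite mxE mulr0. Qed.

Lemma dotZr (R : realType) m (c : R) (x y : 'cV[R]_m) :
  dot x (c *: y) = c * dot x y.
Proof. by rewrite /dot mulr_sumr; apply: eq_bigr => i _; rewrite mxE mulrCA. Qed.

Lemma dotZl (R : realType) m (c : R) (x y : 'cV[R]_m) :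
  dot (c *: x) y = c * dot x y.
Proof. by rewrite /dot mulr_sumr; apply: eq_bigr => i _; rewrite mxE mulrA. Qed.

(** The entry 1 / M in the additional coordinate makes the sum over I also record
|I| / M; for orthonormal rows the atoms add up to the identity of dimension
1 + n. *)
Definition atom (R : realType) n M (A : 'M[R]_(n, M)) (j : 'I_M) : 'M[R]_(1 + n) :=
  block_mx (M%:R^-1)%:M 0 0 (col j A *m (col j A)^T).

Lemma atom_sym (R : realType) n M (A : 'M[R]_(n, M)) j : (atom A j)^T = atom A j.
Proof. by rewrite /atom tr_block_mx tr_scalar_mx !trmx0 trmx_mul trmxK. Qed.

Lemma atomE (R : realType) n M (A : 'M[R]_(n, M)) j (a : 'cV_1) (y : 'cV_n) :
  atom A j *m col_mx a y =
    col_mx (M%:R^-1 *: a) ((A^T *m y) j 0 *: col j A).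
Proof.
rewrite mul_block_col !mul0mx addr0 add0r mul_scalar_mx -mulmxA.
congr col_mx; apply/matrixP => i c; rewrite ord1 !mxE big_ord1 !mxE mulrC.
by congr (_ * _); apply: eq_bigr => h _; rewrite !mxE.
Qed.

Lemma dot_col (R : realType) n M (A : 'M[R]_(n, M)) j (y : 'cV_n) :
  dot y (col j A) = (A^T *m y) j 0.
Proof. by rewrite mxE; apply: eq_bigr => i _; rewrite !mxE mulrC. Qed.

Lemma dot_atom (R : realType) n M (A : 'M[R]_(n, M)) j (a : 'cV_1) (y : 'cV_n) :
  dot (col_mx a y) (atom A j *m col_mx a y) =
    M%:R^-1 * dot a a + (A^T *m y) j 0 ^+ 2.
Proof. by rewrite atomE dot_col_mx !dotZr dot_col -expr2. Qed.

Lemma dot_atom_sqr (R : realType) n M (A : 'M[R]_(n, M)) (r : R) j x :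
  M%:R^-1 <= r -> dot (col j A) (col j A) <= r ->
  dot (atom A j *m x) (atom A j *m x) <= r * dot x (atom A j *m x).
Proof.
move=> Mr Ar; rewrite -(vsubmxK x) dot_atom atomE dot_col_mx !dotZl !dotZr.
have M0 : 0 <= M%:R^-1 :> R by rewrite invr_ge0.
have := ler_wpM2r (dot_ge0 (usubmx x)) (ler_wpM2r M0 Mr).
have := ler_wpM2l (sqr_ge0 ((A^T *m dsubmx x) j 0)) Ar; lra.
Qed.

Lemma orthonormal_rows_isometry (R : realType) n M (A : 'M[R]_(n, M)) y :
  orthonormal_rows A -> dot (A^T *m y) (A^T *m y) = dot y y.
Proof.
move=> oA; rewrite dot_mulmx trmxK mulmxA.
suff -> : A *m A^T = 1%:M by rewrite mul1mx.
apply/matrixP => i j; rewrite !mxE -(oA i j) /dot.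
by apply: eq_bigr => h _; rewrite !mxE.
Qed.

Lemma form_atom (R : realType) n M (A : 'M[R]_(n, M)) I (a : 'cV_1) (y : 'cV_n) :
  form (atom A) I (col_mx a y) =
    #|I|%:R / M%:R * dot a a + \sum_(j in I) (A^T *m y) j 0 ^+ 2.
Proof.
rewrite /form; under eq_bigr do rewrite dot_atom.
by rewrite big_split /= sumr_const -[_ *+ #|_|]mulr_natl mulrA.
Qed.

(** Both conclusions are the halving estimate for the atoms, tested on the vectors
(1, 0) and (0, y). *)
Lemma sparse_approximation (R : realType) n M (A : 'M[R]_(n, M)) (r d : R) k l :
  (0 < M)%N -> orthonormal_rows A ->
  M%:R^-1 <= r -> (forall j, dot (col j A) (col j A) <= r) ->
  (n < 2 ^ 2 ^ k)%N ->
  0 <= d <= 1 -> 64 * (2 ^+ l * (2 ^ k)%:R * r) <= d ^+ 2 ->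
  exists I : {set 'I_M},
    `|2 ^+ l * (#|I|%:R / M%:R) - 1| <= d /\
    forall y : 'cV_n,
      `|2 ^+ l * (\sum_(j in I) (A^T *m y) j 0 ^+ 2) - dot y y| <= d * dot y y.
Proof.
move=> M0 oA Mr Ar nk /andP[d0 d1] dl.
have r0 : 0 <= r by apply: le_trans Mr; rewrite invr_ge0.
have MN0 : M%:R != 0 :> R by rewrite pnatr_eq0 -lt0n.
have BT x : form (atom A) [set: 'I_M] x = dot x x.
  rewrite -(vsubmxK x) form_atom dot_col_mx cardsT card_ord divff // mul1r.
  congr (_ + _); rewrite -[RHS](orthonormal_rows_isometry _ oA).
  by apply: eq_big => j; rewrite ?inE // expr2.
have [|I HI] := @iterated_halving _ _ _ (atom A) r k l nk r0 (@atom_sym _ _ _ A)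
    (fun j x => dot_atom_sqr x Mr (Ar j)) BT.
  apply: le_trans (_ : d ^+ 2 <= 1); last by rewrite expr_le1.
  by apply: le_trans dl; lra.
have {}HI x : `|2 ^+ l * form (atom A) I x - dot x x| <= d * dot x x.
  apply: (le_trans (HI x)); rewrite ler_wpM2r ?dot_ge0 //.
  rewrite -(@ler_pXn2r _ 2) ?nnegrE ?mulr_ge0 ?sqrtr_ge0 //.
  rewrite exprMn sqr_sqrtr; first by apply: le_trans dl; lra.
  by rewrite !mulr_ge0 // exprn_ge0.
exists I; split=> [|y].
  have := HI (col_mx 1%:M 0); rewrite form_atom dot_col_mx mulmx0.
  rewrite big1 => [|j _]; last by rewrite mxE expr2 mul0r.
  have -> : dot (1%:M : 'cV[R]_1) 1%:M = 1 by rewrite /dot big_ord1 mxE eqxx mulr1.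
  by rewrite dot0r !addr0 !mulr1.
have := HI (col_mx 0 y); rewrite form_atom dot_col_mx.
by rewrite dot0r mulr0 !add0r.
Qed.

(** * Choice of the parameters *)

Lemma enormE (R : realType) m (x : 'cV[R]_m) : enorm x = Num.sqrt (dot x x).
Proof. by congr Num.sqrt; apply: eq_bigr => i _; rewrite expr2. Qed.

Lemma enorm_coord_proj (R : realType) m (I : {set 'I_m}) (x : 'cV[R]_m) :
  enorm (coord_proj I x) = Num.sqrt (\sum_(i in I) x i 0 ^+ 2).
Proof.
congr Num.sqrt; rewrite [RHS]big_mkcond; apply: eq_bigr => i _.
by rewrite coord_projE; case: ifP => // _; rewrite expr2 mul0r.
Qed.

(** The least such k works: 2^(2^(k-1)) <= n gives 2^k ln 2 <= 2 ln n, and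
ln 2 >= 1/2. *)
Lemma double_exp_bracket (R : realType) n :
  (2 <= n)%N -> exists2 k, (n < 2 ^ 2 ^ k)%N & (2 ^ k)%:R <= 4 * ln n%:R :> R.
Proof.
move=> n2.
have ex : exists k, (n < 2 ^ 2 ^ k)%N.
  by exists n; apply: ltn_trans (ltn_expl _ _) (ltn_expl _ _).
case: (ex_minnP ex) => -[|k] nk kmin; first by move: nk; rewrite ltnNge => /negP[].
exists k.+1 => //.
have kn : (2 ^ 2 ^ k <= n)%N by rewrite leqNgt; apply/negP => /kmin; rewrite ltnn.
have n0 : (0 < n)%N by apply: leq_trans n2.
have ln2 : 1 / 2 <= ln 2 :> R.
  have : ln (1 + - (1 / 2)) <= - (1 / 2) :> R by apply: le_ln1Dx; lra.
  have -> : 1 + - (1 / 2) = 2^-1 :> R by field.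
  by rewrite lnV ?posrE //; lra.
have : ln ((2 ^ 2 ^ k)%:R) <= ln n%:R :> R.
  by rewrite ler_ln ?posrE ?ltr0n ?expn_gt0 // ler_nat.
rewrite natrX lnXn // -[_ *+ (2 ^ k)]mulr_natl.
have := ler_wpM2l (ler0n R (2 ^ k)) ln2.
by rewrite expnS natrM; lra.
Qed.

(** Here u is 2^l times the sum over I and c is 2^l |I| / M, so that u / c is the
sum scaled by M / |I|. *)
Lemma ratio_bounds (R : realType) (eps b c u : R) :
  0 < eps < 1 -> 0 <= b -> `|c - 1| <= eps / 2 -> `|u - b| <= eps / 2 * b ->
  (1 - eps) ^+ 2 * b <= u / c /\ u / c <= (1 + eps) ^+ 2 * b.
Proof.
move=> /andP[e0 e1] b0; rewrite !ler_norml => /andP[c1 c2] /andP[u1 u2].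
have c0 : 0 < c by lra.
rewrite ler_pdivlMr // ler_pdivrMr //; split.
  have : (1 - eps) ^+ 2 * b * c <= (1 - eps) ^+ 2 * b * (1 + eps / 2).
    by apply: ler_wpM2l; [rewrite mulr_ge0 ?sqr_ge0 | lra].
  have : (1 - eps) ^+ 2 * (1 + eps / 2) * b <= (1 - eps / 2) * b.
    by apply: ler_wpM2r => //; nra.
  lra.
have : (1 + eps) ^+ 2 * b * (1 - eps / 2) <= (1 + eps) ^+ 2 * b * c.
  by apply: ler_wpM2l; [rewrite mulr_ge0 ?sqr_ge0 | lra].
have : (1 + eps / 2) * b <= (1 + eps) ^+ 2 * (1 - eps / 2) * b.
  by apply: ler_wpM2r => //; nra.
lra.
Qed.

Lemma sqr_col_bound (R : realType) n M (A : 'M[R]_(n, M)) (t : R) j :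
  (0 < n)%N -> (0 < M)%N -> 0 <= t ->
  Num.sqrt (M%:R / n%:R) * Num.sqrt (\sum_(i < n) A i j ^+ 2) <= t ->
  dot (col j A) (col j A) <= t ^+ 2 * n%:R / M%:R.
Proof.
move=> n0 M0 t0.
have -> : \sum_(i < n) A i j ^+ 2 = dot (col j A) (col j A).
  by apply: eq_bigr => i _; rewrite !mxE expr2.
rewrite -sqrtrM ?divr_ge0 // => st.
have : Num.sqrt (M%:R / n%:R * dot (col j A) (col j A)) ^+ 2 <= t ^+ 2.
  by rewrite ler_pXn2r ?nnegrE ?sqrtr_ge0.
rewrite sqr_sqrtr; last by rewrite mulr_ge0 ?divr_ge0 ?dot_ge0.
rewrite ler_pdivlMr ?ltr0n //.
by rewrite mulrAC ler_pdivrMr ?ltr0n // mulrC.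
Qed.

Lemma exists_last_pow2 (R : realType) (a b : R) :
  0 < a -> a <= b -> exists l, 2 ^+ l * a <= b < 2 ^+ l.+1 * a.
Proof.
move=> a0 ab.
have ex : exists l, b < 2 ^+ l * a.
  exists (Num.bound (b / a)); rewrite -ltr_pdivrMr //.
  apply: lt_le_trans (archi_boundP _) _.
    by rewrite divr_ge0 // (le_trans (ltW a0)) // ltW.
  by rewrite -natrX ler_nat ltnW // ltn_expl.
case: (ex_minnP ex) => -[|l] bl lmin; first by move: bl; rewrite expr0 mul1r ltNge ab.
exists l; rewrite bl andbT leNgt; apply/negP => /lmin; by rewrite ltnn.
Qed.

(* n >= 2: for n = 1 the bound on #|I| is 0 since log 1 = 0. When I is empty,
   M / 0 = 0 and the middle term is 0. *)
Theorem mainTheorem1 (R : realType) :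
  exists C : R, 0 < C /\
    forall (t : R) (n M : nat) (A : 'M[R]_(n, M)),
      1 <= t -> (2 <= n)%N -> (n < M)%N ->
      orthonormal_rows A ->
      (forall j : 'I_M,
         Num.sqrt (M%:R / n%:R) * Num.sqrt (\sum_(i < n) A i j ^+ 2) <= t) ->
      forall eps : R, 0 < eps ->
        exists I : {set 'I_M},
          #|I|%:R <= C * (t ^+ 2 / eps ^+ 2) * n%:R * ln n%:R /\
          forall x : 'cV[R]_n,
            (1 - eps) * enorm x
              <= Num.sqrt (M%:R / #|I|%:R) * enorm (coord_proj I (A^T *m x)) /\
            Num.sqrt (M%:R / #|I|%:R) * enorm (coord_proj I (A^T *m x))
              <= (1 + eps) * enorm x.
Proof.
exists 3072; split=> // t n M A t1 n2 nM oA tA eps e0.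
have n0 : (0 < n)%N by apply: leq_trans n2.
have M0 : (0 < M)%N by apply: leq_trans nM.
have MR0 : 0 < M%:R :> R by rewrite ltr0n.
have lnn : 0 <= ln n%:R :> R by rewrite ln_ge0 // ler1n.
have t0 : 0 <= t by apply: le_trans t1.
have rhs0 p : 0 <= p -> 0 <= p * (t ^+ 2 / eps ^+ 2) * n%:R :> R.
  by move=> ?; rewrite !mulr_ge0 ?invr_ge0 ?sqr_ge0.
have [e1|e1] := leP 1 eps.
  exists set0; rewrite cards0 invr0 mulr0 sqrtr0; split.
    by rewrite mulr_ge0 // rhs0.
  move=> x; have x0 : 0 <= enorm x by apply: sqrtr_ge0.
  rewrite !mul0r mulr_ge0 ?addr_ge0 ?(ltW e0) //; split=> //.
  by rewrite mulr_le0_ge0 // subr_le0.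
have [k nk kln] := double_exp_bracket R n2; set p := (2 ^ k)%:R in kln.
have p0 : 0 < p by rewrite ltr0n expn_gt0.
pose r := t ^+ 2 * n%:R / M%:R.
have t2 : 1 <= t ^+ 2 by rewrite expr_ge1.
have Mr : M%:R^-1 <= r.
  rewrite -[leLHS]mul1r ler_pM2r ?invr_gt0 // -[leLHS]mulr1.
  by apply: ler_pM; rewrite ?ler1n.
have r0 : 0 < r by apply: lt_le_trans Mr; rewrite invr_gt0.
have e20 : 0 < eps ^+ 2 by rewrite exprn_gt0.
(* 3072 = 4 * 768, where the 4 comes from p <= 4 ln n. *)
have card_bound (I : {set 'I_M}) :
    #|I|%:R * eps ^+ 2 <= 768 * p * (t ^+ 2 * n%:R) ->
    #|I|%:R <= 3072 * (t ^+ 2 / eps ^+ 2) * n%:R * ln n%:R.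
  rewrite -ler_pdivlMr // => /le_trans; apply.
  have -> : 768 * p * (t ^+ 2 * n%:R) / eps ^+ 2 =
      768 * (t ^+ 2 / eps ^+ 2) * n%:R * p by ring.
  apply: le_trans (ler_wpM2l (rhs0 768 _) kln) _ => //; lra.
have Er : M%:R * r = t ^+ 2 * n%:R by rewrite /r mulrC divfK ?gt_eqF.
(* If eps^2 < 256 p r, multiplying by M bounds M itself by the right-hand side. *)
have [large|small] := ltP (eps ^+ 2) (256 * p * r).
  exists [set: 'I_M]; split.
    apply: card_bound; rewrite cardsT card_ord -Er.
    have := ler_wpM2l (ltW MR0) (ltW large).
    have := mulr_ge0 (ltW MR0) (mulr_ge0 (ltW p0) (ltW r0)).
    lra.
  move=> x; rewrite cardsT card_ord divff ?gt_eqF // sqrtr1 mul1r.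
  have -> : enorm (coord_proj [set: 'I_M] (A^T *m x)) = enorm x.
    rewrite enorm_coord_proj enormE -(orthonormal_rows_isometry x oA).
    by congr Num.sqrt; apply: eq_big => i; rewrite ?inE // expr2.
  by have x0 : 0 <= enorm x; [exact: sqrtr_ge0 | split; nra].
have [l /andP[l1 l2]] := exists_last_pow2 (mulr_gt0 (mulr_gt0 (ltr0n R 256) p0) r0) small.
have [||I [cI qI]] := @sparse_approximation _ _ _ A r (eps / 2) k l M0 oA Mr
    (fun j => sqr_col_bound n0 M0 t0 (tA j)) nk.
- by apply/andP; split; lra.
- by rewrite exprMn -/p; lra.
have pl0 : 0 < 2 ^+ l :> R by rewrite exprn_gt0.
have I0 : 0 < #|I|%:R :> R.
  rewrite lt0r ler0n andbT; apply: contraTneq cI => ->.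
  by rewrite mul0r mulr0 sub0r normrN normr1 -ltNge; lra.
(* |I| <= (3/2) M / 2^l, and maximality of l gives 1 / 2^l < 512 p r / eps^2;
   hence the constant 768. *)
exists I; split.
  apply: card_bound.
  move: cI; rewrite ler_norml => /andP[_ cI].
  have {}cI : 2 ^+ l * #|I|%:R <= 3 / 2 * M%:R :> R.
    by rewrite -ler_pdivrMr // -mulrA; lra.
  rewrite -(ler_pM2l pl0) -Er.
  have := ler_wpM2r (ltW e20) cI.
  have := ler_wpM2l (ltW MR0) (ltW l2); rewrite (exprS _ l); lra.
move=> x; rewrite enorm_coord_proj enormE.
have e01 : 0 < eps < 1 by rewrite e0.
have [lo up] := ratio_bounds e01 (dot_ge0 x) cI (qI x).
set q := \sum_(i in I) _ in lo up *.
have Eq : 2 ^+ l * q / (2 ^+ l * (#|I|%:R / M%:R)) = M%:R / #|I|%:R * q.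
  by field; rewrite !gt_eqF.
rewrite {}Eq in lo up.
rewrite -sqrtrM ?divr_ge0 //.
have sqrtE c : 0 <= c -> c * Num.sqrt (dot x x) = Num.sqrt (c ^+ 2 * dot x x).
  by move=> c0; rewrite sqrtrM ?sqr_ge0 // sqrtr_sqr ger0_norm.
by rewrite !sqrtE ?ler_wsqrtr //; lra.
Qed.
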